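(* Let $M$ be a regular matroid. (a) If $e$ is an element of the ground set of $M$ that is not a coloop and $r(M/e)\geq 3$, then $$\operatorname{sys}_3^*(M\backslash e)\leq \operatorname{sys}_3^*(M)\leq \operatorname{sys}_3^*(M/e).$$ (b) If $\operatorname{si}(M)$ denotes the simplification of $M$, and $M$ has at least one triple of cocircuits with the non-inclusion property (so that $\operatorname{sys}_3^*(M)$ is defined), then $$\operatorname{sys}_3^*(M)=\operatorname{sys}_3^*(\operatorname{si}(M)).$$
   Context: Matroids are finite; $r$ denotes rank, $M\backslash e$ deletion and $M/e$ contraction. The simplification $\operatorname{si}(M)$ is obtained from $M$ by deleting all loops and all but one element of each parallel class. A triple of cocircuits $C_1^*,C_2^*,C_3^*$ of a matroid has the non-inclusion property if $C_h^*\not\subseteq C_i^*\cup C_j^*$ for all $\{h,i,j\}=\{1,2,3\}$. For a matroid $M$ with ground set $E$ having at least one such triple (every matroid of rank at least three does), the $3$-cosystole is $$\operatorname{sys}_3^*(M)=\max_\mu\ \min\ \sum_{i=1}^3\mu(C_i^* ),$$ where the maximum runs over functions $\mu:E\to\mathbb{R}_{\geq 0}$ with $\mu(E)=1$, the minimum runs over all triples of cocircuits of $M$ with the non-inclusion property, and $\mu(X)=\sum_{e\in X}\mu(e)$ for $X\subseteq E$. *)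

(* Defs.v *)
From HB Require Import structures.
From mathcomp Require Import all_boot all_order all_algebra.

Set Implicit Arguments.
Unset Strict Implicit.
Unset Printing Implicit Defensive.

Import Order.TTheory GRing.Theory Num.Theory.

(* The ground set is a subset of the carrier [T], so that deletion and
   contraction stay within [matroid T]. *)
Record matroid (T : finType) := Matroid {
  ground : {set T};
  indep : {set {set T}};
  indep_ground : forall I : {set T}, I \in indep -> I \subset ground;
  indep0 : set0 \in indep;
  indep_sub : forall I J : {set T}, J \in indep -> I \subset J -> I \in indep;
  indep_aug : forall I J : {set T}, I \in indep -> J \in indep -> #|I| < #|J| ->
    exists2 x, x \in J :\: I & x |: I \in indep
}.

Section Matroid.

Context {T : finType}.
Implicit Types (M N : matroid T) (e f : T) (I J B C X : {set T}).

Definition rk M X : nat := \max_(I in indep M | I \subset X) #|I|.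

Definition basis M B : bool := maxset (fun X => X \in indep M) B.

Definition circuit M C : bool :=
  minset (fun X => (X \subset ground M) && (X \notin indep M)) C.

Definition loop M e : bool := circuit M [set e].

Lemma basis_exists M : exists B, basis M B.
Proof.
by have [B hB _] := maxset_exists (P := fun X => X \in indep M) (indep0 M);
   exists B.
Qed.

Lemma basis_indep M B : basis M B -> B \in indep M.
Proof. by case/maxsetP. Qed.

Lemma leq_basis M B I : basis M B -> I \in indep M -> #|I| <= #|B|.
Proof.
case/maxsetP=> hB maxB hI; rewrite leqNgt; apply/negP=> ltBI.
have [x /setDP[_ xNB] hx] := indep_aug hB hI ltBI.
by move: xNB; rewrite -(maxB _ hx (subsetUr _ _)) setU11.
Qed.

Lemma basis_extend M I B : I \in indep M -> basis M B ->
  exists B', [/\ basis M B', I \subset B' & B' \subset I :|: B].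
Proof.
move=> hI hB.
have PI : (I \in indep M) && (I \subset I :|: B) by rewrite hI subsetUl.
have [B' /maxsetP[/andP[hB' sB'] max'] sIB'] :=
  maxset_exists (P := fun X => (X \in indep M) && (X \subset I :|: B)) PI.
exists B'; split=> //.
have leBB' : #|B| <= #|B'|.
  rewrite leqNgt; apply/negP=> lt.
  have [x /setDP[xB xNB'] hx] := indep_aug hB' (basis_indep hB) lt.
  have /max' eqx : (x |: B' \in indep M) && (x |: B' \subset I :|: B).
    by rewrite hx subUset sub1set sB' inE xB orbT.
  by move: xNB'; rewrite -eqx ?setU11 ?subsetUr.
apply/maxsetP; split=> // X hX sB'X; apply/esym/eqP.
by rewrite eqEcard sB'X (leq_trans (leq_basis hB hX)).
Qed.

Definition dual_indep M : {set {set T}} :=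
  [set I : {set T} | (I \subset ground M) &&
     [exists B, basis M B && (I \subset ground M :\: B)]].

Lemma dual_indepP M I :
  reflect (I \subset ground M /\ exists2 B, basis M B & [disjoint I & B])
          (I \in dual_indep M).
Proof.
rewrite inE; apply: (iffP andP) => -[sI].
  case/existsP=> B /andP[hB]; rewrite subsetD => /andP[_ d].
  by split=> //; exists B.
by case=> B hB d; split=> //; apply/existsP; exists B; rewrite hB subsetD sI d.
Qed.

Lemma dual_ground M I : I \in dual_indep M -> I \subset ground M.
Proof. by case/dual_indepP. Qed.

Lemma dual_indep0 M : set0 \in dual_indep M.
Proof.
have [B hB] := basis_exists M.
by apply/dual_indepP; split; [exact: sub0set | exists B; rewrite ?disjoints0 // -setI_eq0 set0I].
Qed.

Lemma dual_sub M I J : J \in dual_indep M -> I \subset J -> I \in dual_indep M.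
Proof.
case/dual_indepP=> sJ [B hB d] sIJ; apply/dual_indepP; split.
  exact: subset_trans sJ.
by exists B => //; apply: disjointWl d.
Qed.

Lemma dual_aug M I J : I \in dual_indep M -> J \in dual_indep M -> #|I| < #|J| ->
  exists2 x, x \in J :\: I & x |: I \in dual_indep M.
Proof.
case/dual_indepP=> sI [BI hBI dI] /dual_indepP[sJ [BJ hBJ dJ]] ltIJ.
have hD : BJ :\: I \in indep M by apply: indep_sub (basis_indep hBJ) (subsetDl _ _).
have [B [hB sDB sB]] := basis_extend hD hBI.
have dIB : [disjoint I & B].
  apply: disjointWr sB _; rewrite -setI_eq0 setIUr setU_eq0 !setI_eq0 dI andbT.
  by rewrite -setI_eq0; apply/eqP/setP=> x; rewrite !inE; case: (x \in I).
have [x xJI xNB] : exists2 x, x \in J :\: I & x \notin B.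
  apply/subsetPn; apply/negP=> sJIB.
  have dd : [disjoint J :\: I & BJ :\: I].
    by apply: disjointW dJ; rewrite ?subsetDl.
  have : #|(J :\: I) :|: (BJ :\: I)| <= #|BJ|.
    apply: leq_trans (leq_basis hBJ (basis_indep hB)).
    by apply: subset_leq_card; rewrite subUset sJIB sDB.
  rewrite cardsU disjoint_setI0 // cards0 subn0 -[X in _ <= X](cardsID I) leq_add2r.
  apply/negP; rewrite -ltnNge.
  have : #|BJ :&: I| <= #|I :\: J|.
    apply: subset_leq_card; apply/subsetP=> y; rewrite !inE => /andP[yB ->].
    by rewrite andbT; apply: contraTN yB => yJ; rewrite (disjointFr dJ yJ).
  move=> /leq_ltn_trans; apply.
  by rewrite -(ltn_add2l #|I :&: J|) cardsID setIC cardsID.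
exists x => //; apply/dual_indepP; split.
  by rewrite subUset sI sub1set (subsetP sJ) //; case/setDP: xJI.
by exists B => //; rewrite -setI_eq0 setIUl setU_eq0 !setI_eq0 disjoints1 xNB.
Qed.

Definition mdual M : matroid T :=
  @Matroid T (ground M) (dual_indep M) (@dual_ground M) (dual_indep0 M)
    (@dual_sub M) (@dual_aug M).

Definition cocircuit M C : bool := circuit (mdual M) C.

Definition coloop M e : bool := loop (mdual M) e.

Definition mdelete_indep M X : {set {set T}} :=
  [set I in indep M | [disjoint I & X]].

Lemma mdelete_ground M X I : I \in mdelete_indep M X -> I \subset ground M :\: X.
Proof. by rewrite inE subsetD => /andP[/indep_ground-> ->]. Qed.

Lemma mdelete_indep0 M X : set0 \in mdelete_indep M X.
Proof. by rewrite inE indep0 -setI_eq0 set0I eqxx. Qed.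

Lemma mdelete_sub M X I J :
  J \in mdelete_indep M X -> I \subset J -> I \in mdelete_indep M X.
Proof.
by rewrite !inE => /andP[hJ d] sIJ; rewrite (indep_sub hJ) //= (disjointWl sIJ).
Qed.

Lemma mdelete_aug M X I J :
  I \in mdelete_indep M X -> J \in mdelete_indep M X -> #|I| < #|J| ->
  exists2 x, x \in J :\: I & x |: I \in mdelete_indep M X.
Proof.
rewrite !inE => /andP[hI dI] /andP[hJ dJ] /(indep_aug hI hJ)[x xJI hx].
exists x; rewrite // inE hx -setI_eq0 setIUl setU_eq0 !setI_eq0 dI disjoints1 andbT.
by case/setDP: xJI => xJ _; rewrite (disjointFr dJ xJ).
Qed.

Definition mdelete M X : matroid T :=
  @Matroid T (ground M :\: X) (mdelete_indep M X) (@mdelete_ground M X)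
    (mdelete_indep0 M X) (@mdelete_sub M X) (@mdelete_aug M X).

Definition mcontract M X : matroid T := mdual (mdelete (mdual M) X).

Definition nonloops M : {set T} := [set e in ground M | ~~ loop M e].

Definition parallel M e f : bool := (e == f) || circuit M [set e; f].

Definition parallel_classes M : {set {set T}} :=
  equivalence_partition (parallel M) (nonloops M).

(* The simplification depends on the choice [X] of one element in each
   parallel class; [N] is the one obtained for some choice. *)
Definition simplification M N : Prop :=
  exists2 X, is_transversal X (parallel_classes M) (nonloops M)
           & N = mdelete M (ground M :\: X).

Lemma nonloopE M e : (e \in nonloops M) = ([set e] \in indep M).
Proof.
rewrite inE; case: (boolP ([set e] \in indep M)) => h.
  have /= := indep_ground h; rewrite sub1set => ->.
  by apply/negP=> /minsetP[/andP[_]]; rewrite h.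
case: (boolP (e \in ground M)) => //= eM; apply/negbF/minsetP; split.
  by rewrite sub1set eM.
move=> X /andP[_ hX]; rewrite subset1 => /orP[/eqP //|/eqP X0].
by rewrite X0 indep0 in hX.
Qed.

Lemma parallelE M : {in nonloops M &, forall e f,
  parallel M e f = (e == f) || ([set e; f] \notin indep M)}.
Proof.
move=> e f; rewrite !nonloopE /parallel => he hf; congr (_ || _).
apply/idP/idP=> [/minsetP[/andP[]] //|h]; apply/minsetP; split.
  by rewrite h subUset !indep_ground.
move=> X /andP[_ hX] sX; apply/eqP; rewrite eqEsubset sX /= subUset !sub1set.
apply/andP; split; apply: contraR hX => hX.
  apply: indep_sub hf _; apply/subsetP=> x xX; have := subsetP sX x xX.
  by rewrite !inE => /orP[/eqP xe|//]; rewrite xe (negPf hX) in xX.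
apply: indep_sub he _; apply/subsetP=> x xX; have := subsetP sX x xX.
by rewrite !inE => /orP[//|/eqP xe]; rewrite xe (negPf hX) in xX.
Qed.

Lemma parallel_equiv M : {in nonloops M & &, equivalence_rel (parallel M)}.
Proof.
have sym e f : parallel M e f = parallel M f e.
  by rewrite /parallel eq_sym setUC.
have tr : {in nonloops M & &, forall f e g,
    parallel M e f -> parallel M f g -> parallel M e g}.
  move=> f e g nf ne ng; rewrite !parallelE //.
  case: (eqVneq e f) => [-> //|nef] /= hef.
  case: (eqVneq f g) => [<- _|nfg] /=; first by rewrite hef orbT.
  case: (eqVneq e g) => //= neg hfg; apply: contra hef => heg.
  have [||x] := @indep_aug _ M [set f] [set e; g] _ heg.
  - by rewrite -nonloopE.
  - by rewrite cards1 cards2 neg.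
  rewrite !inE => /andP[_ /orP[]/eqP-> //] h.
  by rewrite setUC h in hfg.
move=> e f g ne nf ng; split; first by rewrite /parallel eqxx.
move=> hef; apply/idP/idP; last exact: tr.
by apply: tr => //; rewrite sym.
Qed.

Lemma simplification_exists M : exists N, simplification M N.
Proof.
have P := equivalence_partitionP (@parallel_equiv M).
by exists (mdelete M (ground M :\: transversal (parallel_classes M) (nonloops M)));
   exists (transversal (parallel_classes M) (nonloops M)) => //; apply: transversalP.
Qed.

(* The three conditions exhaust all {h,i,j} = {1,2,3}. *)
Definition noninclusion C1 C2 C3 : bool :=
  [&& ~~ (C1 \subset C2 :|: C3), ~~ (C2 \subset C1 :|: C3)
    & ~~ (C3 \subset C1 :|: C2)].

Definition cotriples M : {set {set T} * {set T} * {set T}} :=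
  [set C : {set T} * {set T} * {set T} |
    [&& cocircuit M C.1.1, cocircuit M C.1.2, cocircuit M C.2
      & noninclusion C.1.1 C.1.2 C.2]].

End Matroid.

Section Regular.

Local Open Scope ring_scope.

Definition totally_unimodular m n (A : 'M[rat]_(m, n)) : Prop :=
  forall k (f : 'I_k -> 'I_m) (g : 'I_k -> 'I_n), injective f -> injective g ->
    \det (mxsub f g A) \in [:: 0; 1; -1].

(* The columns of [A] are indexed by the ground set through [enum_val];
   the right-hand side says that the columns in [J] are linearly independent. *)
Definition represents (T : finType) (M : matroid T)
    m (A : 'M[rat]_(m, #|ground M|)) : Prop :=
  forall J : {set 'I_#|ground M|},
    ([set enum_val j | j in J] \in indep M) =
    row_free (colsub (@enum_val _ (mem J)) A)^T.

Definition regular_matroid (T : finType) (M : matroid T) : Prop :=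
  exists m (A : 'M[rat]_(m, #|ground M|)),
    totally_unimodular A /\ represents A.

End Regular.

From mathcomp Require Import all_classical all_reals all_analysis.
Import numFieldNormedType.Exports.

Section Cosystole.

Local Open Scope classical_set_scope.
Local Open Scope ring_scope.

Context (R : realType) {T : finType}.
Implicit Types (M : matroid T) (mu : T -> R).

(* Only the values of [mu] on the ground set matter. *)
Definition prob_weight M mu : Prop :=
  (forall e, e \in ground M -> 0 <= mu e) /\ \sum_(e in ground M) mu e = 1.

Definition triple_weight mu (C : {set T} * {set T} * {set T}) : R :=
  \sum_(e in C.1.1) mu e + \sum_(e in C.1.2) mu e + \sum_(e in C.2) mu e.

Definition min_triple_weight M mu : R :=
  inf [set triple_weight mu C | C in [set` cotriples M]].

(* The infimum and the supremum are attained when [M] has a triple of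
   cocircuits with the non-inclusion property: see [min_triple_weightP] and
   [sys3P]. *)
Definition sys3 M : R :=
  sup [set min_triple_weight M mu | mu in [set mu | prob_weight M mu]].

Lemma min_triple_weightP M mu : cotriples M != finset.set0 ->
  exists2 C, C \in cotriples M & min_triple_weight M mu = triple_weight mu C /\
    forall C', C' \in cotriples M -> triple_weight mu C <= triple_weight mu C'.
Proof.
move=> /finset.set0Pn[C0 hC0].
have [C hC minC] := @arg_minP _ R _ C0 (mem (cotriples M)) (triple_weight mu) hC0.
exists C => //; split=> //; apply/eqP; rewrite eq_le; apply/andP; split.
  apply: ge_inf; last by exists C.
  by exists (triple_weight mu C) => _ [C' hC' <-]; exact: minC.
apply: lb_le_inf; first by exists (triple_weight mu C), C.
by move=> _ [C' hC' <-]; exact: minC.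
Qed.

Lemma min_triple_weight_le M mu C : C \in cotriples M ->
  min_triple_weight M mu <= triple_weight mu C.
Proof.
move=> hC; have [|C' _ [-> ]] := @min_triple_weightP M mu; last exact.
by apply/finset.set0Pn; exists C.
Qed.

Lemma cocircuit_ground M C : cocircuit M C -> C \subset ground M.
Proof. by case/minsetP=> /andP[]. Qed.

Lemma triple_weight_eq M mu mu' C : C \in cotriples M ->
  {in ground M, mu =1 mu'} -> triple_weight mu C = triple_weight mu' C.
Proof.
rewrite finset.inE => /and4P[h1 h2 h3 _] eqmu; rewrite /triple_weight.
by congr (_ + _ + _); apply: eq_bigr => e eC; apply: eqmu;
  apply: (fintype.subsetP (cocircuit_ground _)) eC.
Qed.

Lemma min_triple_weight_eq M mu mu' : cotriples M != finset.set0 ->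
  {in ground M, mu =1 mu'} -> min_triple_weight M mu = min_triple_weight M mu'.
Proof.
move=> M0 eqmu; have [C hC [-> minC]] := min_triple_weightP mu M0.
have [C' hC' [-> minC']] := min_triple_weightP mu' M0.
apply/eqP; rewrite eq_le (triple_weight_eq hC eqmu) minC' // andbT.
by rewrite -!(triple_weight_eq _ eqmu) // minC.
Qed.

Lemma ground_neq0 M : cotriples M != finset.set0 -> exists e, e \in ground M.
Proof.
case/finset.set0Pn=> C; rewrite finset.inE => /and4P[h1 _ _ /and3P[+ _ _]].
move=> /fintype.subsetPn[e eC _]; exists e.
exact: (fintype.subsetP (cocircuit_ground h1)).
Qed.

Let sum_coord_continuous (X : {set T}) :
  continuous (fun mu : prod_topology (fun _ : T => R) => \sum_(e in X) mu e).
Proof.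
apply: continuous_big => [|e _]; first exact: add_continuous.
exact: (@proj_continuous T (fun=> R) e).
Qed.

Let min_triple_weight_continuous M : cotriples M != finset.set0 ->
  continuous (min_triple_weight M : prod_topology (fun _ : T => R) -> R).
Proof.
move=> M0; have [C0 hC0] := finset.set0Pn _ M0.
have -> : (min_triple_weight M : prod_topology (fun _ : T => R) -> R) =
    (fun mu => \big[Num.min/triple_weight mu C0]_(C in cotriples M) triple_weight mu C).
  apply/funext => mu; have [C hC [-> minC]] := min_triple_weightP mu M0.
  apply/eqP; rewrite eq_le; apply/andP; split; last exact: bigmin_le_cond.
  by apply/bigmin_geP; split=> [|C' hC']; exact: minC.
have cw C : continuous
    ((fun mu => triple_weight mu C) : prod_topology (fun _ : T => R) -> R).
  pose S (X : {set T}) (mu : prod_topology (fun _ : T => R)) : R := \sum_(e in X) mu e.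
  have cS X : continuous (S X) by exact: sum_coord_continuous.
  move=> mu; apply: (@continuousD R R _ (S C.1.1 \+ S C.1.2) (S C.2)); last exact: cS.
  by apply: (@continuousD R R _ (S C.1.1) (S C.1.2)); exact: cS.
pose m s (mu : prod_topology (fun _ : T => R)) : R :=
  \big[Num.min/triple_weight mu C0]_(C <- s) triple_weight mu C.
have cm s : continuous (m s).
  elim: s => [|C s IH].
    have -> : m [::] = fun mu => triple_weight mu C0 by apply/funext => mu; rewrite /m big_nil.
    exact: cw.
  have -> : m (C :: s) = (fun mu => triple_weight mu C) \min m s.
    by apply/funext => mu; rewrite /m big_cons.
  by move=> mu; apply: (@continuous_min R _ _ _ mu (cw C mu) (IH mu)).
rewrite (_ : (fun mu => _) = m (enum (cotriples M))); first exact: cm.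
by apply/funext => mu; rewrite /m big_enum.
Qed.

Lemma sys3P M : cotriples M != finset.set0 ->
  exists2 mu, prob_weight M mu & sys3 M = min_triple_weight M mu /\
    forall mu', prob_weight M mu' -> min_triple_weight M mu' <= min_triple_weight M mu.
Proof.
move=> M0; have [e0 e0M] := ground_neq0 M0.
pose K : set (prod_topology (fun _ : T => R)) :=
  [set mu | forall e, `[0, 1]%classic (mu e)] `&`
  [set mu | \sum_(e in ground M) mu e = 1].
have cK : compact K.
  apply: compact_closedI.
    by apply: (@tychonoff T (fun=> R) (fun=> `[0, 1]%classic)) => e; exact: segment_compact.
  apply: (@preimage_closed _ _ (fun mu : prod_topology (fun _ : T => R) =>
    \sum_(e in ground M) mu e) [set x | x = 1]); last exact: closed_eq.
  by move=> mu _; exact: sum_coord_continuous.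
have K0 : K !=set0.
  exists (fun e => (e == e0)%:R); split=> [e /=|/=].
    by rewrite in_itv /=; case: (e == e0); rewrite ?ler01 lexx.
  rewrite (bigD1 e0) //= eqxx big1 ?addr0 // => e /andP[_ /negPf-> //].
have toK mu : prob_weight M mu ->
    exists2 mu', K mu' & min_triple_weight M mu = min_triple_weight M mu'.
  move=> [mu0 mu1]; exists (fun e => if e \in ground M then mu e else 0).
    split=> [e /=|/=]; last by rewrite -[RHS]mu1; apply: eq_bigr => e ->.
    rewrite in_itv /=; case: ifPn => eM; last by rewrite lexx ler01.
    rewrite mu0 //= -mu1 (bigD1 e) //= lerDl; apply: sumr_ge0 => f /andP[fM _].
    exact: mu0.
  by apply: min_triple_weight_eq => // e /= ->.
have [mu Kmu maxmu] := compact_EVT_max K0 cK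
  (continuous_subspaceT (min_triple_weight_continuous M0)).
have [mu01 mu1] := set_mem Kmu.
have pmu : prob_weight M mu.
  by split=> // e _; have := mu01 e; rewrite /= in_itv /= => /andP[].
have max' mu' : prob_weight M mu' -> min_triple_weight M mu' <= min_triple_weight M mu.
  by move=> /toK[mu'' K'' ->]; apply: maxmu; apply/mem_set.
exists mu => //; split=> //; apply/eqP; rewrite eq_le; apply/andP; split.
  apply: ge_sup; first by exists (min_triple_weight M mu), mu.
  by move=> _ [mu' p' <-]; exact: max'.
apply: ub_le_sup; last by exists mu.
by exists (min_triple_weight M mu) => _ [mu' p' <-]; exact: max'.
Qed.

End Cosystole.

(* Main.v *)
(* Part (b) and the second inequality of (a) hold for every matroid: cocircuits
   of [M / e] are the cocircuits of [M] avoiding [e], cocircuits of [si(M)] are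
   the traces of those of [M], which are unions of parallel classes, and in both
   cases a weight on [M] can be pushed forward.

   The first inequality of (a) uses that regular matroids are binary.  Extend a
   weight on [M \ e] by 0 at [e] and let [C1, C2, C3] be a triple of [M].  The
   sets [Ci - e] are cocycles of [M \ e], hence unions of cocircuits, and they
   can be shrunk to a triple of [M \ e] unless, say, [C1 - (C2 u C3) = {e}].  In
   that case [C1 - e] is nonempty, since [e] is not a coloop, and replacing [C2]
   by [C1 + C2], or [C3] by [C1 + C3], or both (sums modulo 2) gives a triple of
   cocycles with the non-inclusion property and no larger weight. *)

Require Import Defs.
From mathcomp Require Import all_boot all_order all_algebra all_reals.
From mathcomp Require Import lra.
From mathcomp Require boolp.

Local Open Scope ring_scope.

Set Implicit Arguments.
Unset Strict Implicit.
Unset Printing Implicit Defensive.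

Import Order.TTheory GRing.Theory Num.Theory.

(** * Duality and fundamental cocircuits *)

Section Matroid.

Context {T : finType}.
Implicit Types (M N : matroid T) (e f x y : T) (I J B C D X Y : {set T}).

Lemma basis_ground M B : basis M B -> B \subset ground M.
Proof. by move/basis_indep/indep_ground. Qed.

Lemma card_basis M B I : basis M B -> I \in indep M -> #|I| = #|B| -> basis M I.
Proof.
move=> hB hI eqIB; apply/maxsetP; split=> // J hJ sIJ.
by apply/esym/eqP; rewrite eqEcard sIJ eqIB (leq_basis hB hJ).
Qed.

Lemma indep_basis M I : I \in indep M -> exists2 B, basis M B & I \subset B.
Proof.
move=> hI; have [B0 hB0] := basis_exists M.
by have [B [hB sIB _]] := basis_extend hI hB0; exists B.
Qed.

Lemma dependent_circuit M X : X \subset ground M -> X \notin indep M ->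
  exists2 C, circuit M C & C \subset X.
Proof.
move=> sX hX.
have PX : (X \subset ground M) && (X \notin indep M) by rewrite sX.
by have [C hC sCX] := minset_exists
  (P := fun X => (X \subset ground M) && (X \notin indep M)) PX; exists C.
Qed.

(** A set is independent in the double dual iff it avoids a basis of the dual. Those bases are the
    complements of the bases of [M], so avoiding one means lying in a basis of [M]. *)
Lemma mdualK M I : (I \in indep (mdual (mdual M))) = (I \in indep M).
Proof.
apply/(dual_indepP (mdual M))/idP => [[/= sI [B' hB' dIB']]|hI].
  have /dual_indepP[sB' [B hB dB]] := basis_indep hB'.
  have hcB : ground M :\: B \in indep (mdual M).
    apply/dual_indepP; split; first exact: subsetDl.
    by exists B => //; rewrite -setI_eq0 setIDAC setDIl setDv setI0.
  have eB' : ground M :\: B = B'.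
    by have /maxsetP[_] := hB'; apply; rewrite // subsetD sB'.
  apply: (indep_sub (basis_indep hB)); apply/subsetP => x xI.
  have := disjointFr dIB' xI; rewrite -eB' inE (subsetP sI x xI) andbT.
  by move/negbFE.
split; first exact: indep_ground hI.
have [B hB sIB] := indep_basis hI.
exists (ground M :\: B).
  apply/maxsetP; split.
    apply/dual_indepP; split; first exact: subsetDl.
    by exists B => //; rewrite -setI_eq0 setIDAC setDIl setDv setI0.
  move=> Y /dual_indepP[sY [B2 hB2 dY]] sBY.
  have sB2 : B2 \subset B.
    apply/subsetP => x xB2; apply/negPn/negP => xB.
    have := disjointFl dY xB2; rewrite (subsetP sBY) // inE xB.
    exact: (subsetP (basis_ground hB2)).
  (* [Y] contains the complement of [B] and avoids the basis [B2]. Hence [B2] lies in [B] and equals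
     it, so [Y] cannot exceed the complement. *)
  have eB : B = B2 by have /maxsetP[_ m] := hB2; apply: m => //; apply: basis_indep.
  by apply/eqP; rewrite eqEsubset sBY subsetD sY eB dY.
by rewrite disjoint_sym -setI_eq0 setIDAC -setIDA (eqP (_ : I :\: B == set0)) ?setI0 ?setD_eq0.
Qed.

Lemma circuitE M N C : ground M = ground N -> indep M =i indep N ->
  circuit M C = circuit N C.
Proof.
by move=> eG eI; apply: minset_eq => X /=; rewrite eG eI.
Qed.

Lemma circuit_delete M e C :
  circuit (mdelete M [set e]) C = circuit M C && (e \notin C).
Proof.
apply/minsetP/andP => [[/andP[/= sC hC] minC]|[/minsetP[/andP[sC hC] minC] eC]].
  have eC : e \notin C.
    by apply/negP => eC; have := subsetP sC e eC; rewrite !inE eqxx.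
  split=> //; apply/minsetP; split.
    apply/andP; split; first exact: (subset_trans sC (subsetDl _ _)).
    by apply: contra hC => hC; rewrite inE hC disjoint_sym disjoints1.
  move=> X /andP[_ hX] sXC; apply: minC => //.
  apply/andP; split; first exact: subset_trans sC.
  by rewrite inE (negPf hX).
split.
  apply/andP; split; first by rewrite subsetD sC disjoint_sym disjoints1.
  by rewrite inE (negPf hC).
move=> X /andP[/= sX hX] sXC; apply: minC => //; apply/andP; split.
  exact: subset_trans sX (subsetDl _ _).
apply: contra hX => hX; rewrite inE hX disjoint_sym disjoints1.
by apply: contra eC => /(subsetP sXC).
Qed.

(** Contraction is deletion in the dual, so a cocircuit of [M / e] is a circuit of a double dual,
    that is, a circuit of the dual of [M] with [e] deleted. *)
Lemma cocircuit_contract M e C :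
  cocircuit (mcontract M [set e]) C = cocircuit M C && (e \notin C).
Proof.
rewrite /cocircuit -circuit_delete.
by apply: circuitE => // I; rewrite mdualK.
Qed.

(** Cocircuits are the minimal sets meeting every basis. Minimality is put pointwise, through a
    basis meeting [C] in [x] alone, because such a basis exhibits [C] as a fundamental cocircuit. *)
Lemma cocircuitP M C :
  [/\ C \subset ground M, forall B, basis M B -> ~~ [disjoint C & B]
    & forall x, x \in C -> exists2 B, basis M B & B :&: C = [set x]]
  <-> cocircuit M C.
Proof.
split=> [[sC meetC minC]|/minsetP[/andP[/= sC hC] minC]].
  apply/minsetP; split.
    rewrite sC; apply/dual_indepP => -[_ [B /meetC]].
    by move=> /negP.
  move=> X /andP[/= sX /dual_indepP hX] sXC; apply/eqP; rewrite eqEsubset sXC.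
  apply/subsetP => x xC; apply/negPn/negP => xX; have [B hB BC] := minC x xC.
  apply: hX; split=> //; exists B => //; rewrite -setI_eq0; apply/eqP/setP => y.
  rewrite !inE; apply/negP => /andP[yX yB].
  have : y \in B :&: C by rewrite inE yB (subsetP sXC).
  by rewrite BC inE => /eqP eyx; rewrite -eyx yX in xX.
have meetC B : basis M B -> ~~ [disjoint C & B].
  by move=> hB; apply: contra hC => d; apply/dual_indepP; split=> //; exists B.
split=> // x xC.
(* By minimality [C] without [x] is coindependent, so some basis avoids it; that basis still has to
   meet [C]. *)
have /dual_indepP[_ [B hB d]] : C :\ x \in indep (mdual M).
  apply/negPn/negP => h; have := minC (C :\ x).
  rewrite (subset_trans (subsetDl _ _) sC) h => /(_ isT (subsetDl _ _)) eC.
  by move: xC; rewrite -eC !inE eqxx.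
exists B => //.
have sBC : B :&: C \subset [set x].
  apply/subsetP => y; rewrite !inE => /andP[yB yC]; apply/negPn/negP => nyx.
  by have := disjointFl d yB; rewrite !inE nyx yC.
apply/eqP; rewrite eqEsubset sBC sub1set /=.
have := meetC B hB; rewrite -setI_eq0 => /set0Pn[y]; rewrite setIC => yBC.
by have := subsetP sBC y yBC; rewrite inE => /eqP <-.
Qed.

(** The elements that can replace [x] in the basis [B], including [x] itself. *)
Definition fundamental_cocircuit M B x : {set T} :=
  [set y in ground M | (y \notin B :\ x) && (y |: B :\ x \in indep M)].

Lemma fundamental_basis M B x y : basis M B -> x \in B ->
  y \in fundamental_cocircuit M B x -> basis M (y |: B :\ x).
Proof.
move=> hB xB; rewrite inE => /and3P[_ yB hy]; apply: (card_basis hB hy).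
by rewrite cardsU1 yB (cardsD1 x B) xB.
Qed.

Lemma fundamental_cocircuitI M B x : basis M B -> x \in B ->
  B :&: fundamental_cocircuit M B x = [set x].
Proof.
move=> hB xB; apply/setP => y; rewrite !inE.
case: (eqVneq y x) => [->|nyx] /=; last by case: (y \in B); rewrite ?andbF.
by rewrite xB (subsetP (basis_ground hB)) // setD1K // basis_indep.
Qed.

(** Augmenting [B :\ x] from any other basis yields a replacement of [x], so every basis is met.
    Replacing [x] by [y] gives a basis that meets the set in [y] only. *)
Lemma fundamental_cocircuitP M B x : basis M B -> x \in B ->
  cocircuit M (fundamental_cocircuit M B x).
Proof.
move=> hB xB; apply/cocircuitP; split.
- by apply/subsetP => y; rewrite inE => /andP[].
- move=> B' hB'.
  have [||y] := @indep_aug _ M (B :\ x) B' _ (basis_indep hB').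
  + by apply: indep_sub (basis_indep hB) (subsetDl _ _).
  + by apply: leq_trans (leq_basis hB' (basis_indep hB)); rewrite [X in (_ < X)%N](cardsD1 x) xB.
  rewrite inE => /andP[yB yB'] hy; rewrite -setI_eq0; apply/set0Pn; exists y.
  by rewrite !inE in yB *; rewrite yB yB' hy (subsetP (basis_ground hB')).
- move=> y yC; exists (y |: B :\ x); first exact: fundamental_basis.
  apply/setP => z; rewrite in_setI in_setU1 in_set1.
  case: (eqVneq z y) => [->|nzy] /=; first by rewrite yC.
  by rewrite [X in _ && X]inE; case: (z \in B :\ x); rewrite //= andbF.
Qed.

(** [C] avoids [B :\ x] but meets each basis obtained by replacing [x] with some [y], so it contains
    every such [y]; minimality of [C] gives equality. *)
Lemma cocircuit_fundamental M B C x : cocircuit M C -> basis M B ->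
  B :&: C = [set x] -> C = fundamental_cocircuit M B x.
Proof.
move=> hC hB BC; have := set11 x; rewrite -BC inE => /andP[xB xC].
have /cocircuitP[_ meetC _] := hC.
have sFC : fundamental_cocircuit M B x \subset C.
  apply/subsetP => y yF; have := meetC _ (fundamental_basis hB xB yF).
  rewrite -setI_eq0 => /set0Pn[z]; rewrite !inE => /andP[zC /orP[/eqP <- //|]].
  move=> /andP[nzx zB]; have : z \in B :&: C by rewrite inE zB.
  by rewrite BC inE (negPf nzx).
have /minsetP[_ minC] := hC; apply/esym/minC => //.
by have /minsetP[] := fundamental_cocircuitP hB xB.
Qed.

(** The fundamental cocircuits of three elements of a basis each contain their own element and
    neither of the other two. *)
Lemma cotriples_rk M : (3 <= rk M (ground M))%N -> cotriples M != set0.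
Proof.
move=> rk3; have [B hB] := basis_exists M.
have /card_gt2P[x [y [z [[xB yB zB] [xy yz zx]]]]] : (2 < #|B|)%N.
  apply: leq_trans rk3 _; apply/bigmax_leqP => I /andP[hI _].
  exact: leq_basis hB hI.
have notin a b : a \in B -> b \in B -> a != b -> a \notin fundamental_cocircuit M B b.
  move=> aB bB ab; apply/negP => aC.
  have : a \in B :&: fundamental_cocircuit M B b by rewrite inE aB.
  by rewrite fundamental_cocircuitI // inE (negPf ab).
have self a : a \in B -> a \in fundamental_cocircuit M B a.
  by move=> aB; have := set11 a; rewrite -(fundamental_cocircuitI hB aB) inE => /andP[].
apply/set0Pn.
exists (fundamental_cocircuit M B x, fundamental_cocircuit M B y, fundamental_cocircuit M B z).
rewrite !inE /= !fundamental_cocircuitP //=; apply/and3P.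
by split; apply/subsetPn;
  [exists x | exists y | exists z]; rewrite ?self // in_setU negb_or !notin // eq_sym.
Qed.

Lemma cocircuit_neq0 M C : cocircuit M C -> C != set0.
Proof.
move=> /cocircuitP[_ meetC _]; have [B /meetC] := basis_exists M.
by apply: contraNneq => ->; rewrite -setI_eq0 set0I.
Qed.

End Matroid.

(** * Cocycles and the exchange of triples *)

Section Cocycle.

Context {T : finType}.
Implicit Types (M N : matroid T) (e f x y : T) (I J B C D X Y : {set T}).

(** Orthogonality to all circuits over the two-element field, expressed by parity. *)
Definition cocycle M X : Prop :=
  X \subset ground M /\ forall C, circuit M C -> ~~ odd #|C :&: X|.

Definition symdiff X Y : {set T} := (X :\: Y) :|: (Y :\: X).

Lemma odd_symdiff X Y : odd #|symdiff X Y| = odd #|X| (+) odd #|Y|.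
Proof.
have d : [disjoint X :\: Y & Y :\: X].
  by rewrite -setI_eq0; apply/eqP/setP => x; rewrite !inE; case: (x \in X); rewrite ?andbF.
rewrite /symdiff cardsU disjoint_setI0 // cards0 subn0 oddD.
by rewrite -(cardsID Y X) -[in RHS](cardsID X Y) !oddD (setIC Y X) addbACA addbb.
Qed.

Lemma cocycle_symdiff M X Y :
  cocycle M X -> cocycle M Y -> cocycle M (symdiff X Y).
Proof.
move=> [sX hX] [sY hY]; split.
  by rewrite subUset !(subset_trans (subsetDl _ _)).
move=> C hC; have -> : C :&: symdiff X Y = symdiff (C :&: X) (C :&: Y).
  by apply/setP => x; rewrite !inE; case: (x \in C).
by rewrite odd_symdiff (negPf (hX C hC)) (negPf (hY C hC)).
Qed.

Lemma cocycle_delete M X e : cocycle M X -> cocycle (mdelete M [set e]) (X :\ e).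
Proof.
move=> [sX hX]; split; first exact: setSD.
move=> C; rewrite circuit_delete => /andP[hC eC].
rewrite (_ : C :&: (X :\ e) = C :&: X) ?hX //; apply/setP => x; rewrite !inE.
by case: (eqVneq x e) => // ->; rewrite (negPf eC).
Qed.

(* The complement of a cocycle is a flat, since no circuit meets a cocycle in a
   single element. *)
Lemma cocycle_cocircuit M X x : cocycle M X -> x \in X ->
  exists C, [/\ cocircuit M C, x \in C & C \subset X].
Proof.
move=> [sX hX] xX.
have P0 : (set0 \in indep M) && [disjoint X & (set0 : {set T})].
  by rewrite indep0 -setI_eq0 setI0 eqxx.
have [I /maxsetP[/andP[hI dI] maxI] _] := maxset_exists
  (P := fun I : {set T} => (I \in indep M) && [disjoint X & I]) P0.
have xI : x \notin I by rewrite (disjointFr dI).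
(* [I] is a maximal independent set avoiding [X]. A circuit inside [x |: I] would meet [X] in [x]
   alone, which is an odd intersection. *)
have hxI : x |: I \in indep M.
  apply/negPn/negP => h.
  have sxI : x |: I \subset ground M.
    by rewrite subUset sub1set (subsetP sX) // (indep_ground hI).
  have [C hC sC] := dependent_circuit sxI h.
  have CX : C :&: X \subset [set x].
    apply/subsetP => y; rewrite !inE => /andP[/(subsetP sC)].
    by rewrite !inE => /orP[//|yI]; rewrite (disjointFl dI yI).
  have xC : x \in C.
    apply/negPn/negP => xC; have /minsetP[/andP[_ /negP nC] _] := hC; apply: nC.
    apply: indep_sub hI _; apply/subsetP => y yC.
    have := subsetP sC y yC; rewrite !inE => /orP[/eqP eyx|//].
    by rewrite -eyx yC in xC.
  have := hX C hC; rewrite (_ : C :&: X = [set x]) ?cards1 //.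
  by apply/eqP; rewrite eqEsubset CX sub1set inE xC.
have [B hB sB] := indep_basis hxI.
have xB : x \in B by rewrite (subsetP sB) ?setU11.
exists (fundamental_cocircuit M B x); split.
- exact: fundamental_cocircuitP.
- by have := set11 x; rewrite -(fundamental_cocircuitI hB xB) inE => /andP[].
apply/subsetP => y; rewrite inE => /and3P[yM yB hy]; apply/negPn/negP => yX.
have sI : I \subset B :\ x.
  apply/subsetP => z zI; rewrite !inE (subsetP sB) ?andbT ?setU1r //.
  by apply: contraNneq xI => <-.
(* A replacement [y] of [x] outside [X] could be added to [I]; by maximality it already lies in [I],
   hence in [B :\ x], a contradiction. *)
have eI : y |: I = I.
  apply: maxI; last exact: subsetUr.
  rewrite (indep_sub hy) ?setUS //= -setI_eq0 setIUr setU_eq0 !setI_eq0 dI.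
  by rewrite disjoint_sym disjoints1 yX.
by move: yB; rewrite (subsetP sI) // -eI setU11.
Qed.

End Cocycle.

(** * Weights of triples of cocycles *)

Section TripleWeight.

Context (R : realType) {T : finType}.
Implicit Types (N : matroid T) (mu : T -> R) (X Y : {set T}).

Lemma sum_subset mu X Y : {in Y, forall e, 0 <= mu e} -> X \subset Y ->
  \sum_(e in X) mu e <= \sum_(e in Y) mu e.
Proof.
move=> mu0 sXY; rewrite [leRHS](big_setID X) /= (setIidPr sXY) lerDl.
by apply: sumr_ge0 => e; rewrite inE => /andP[_]; exact: mu0.
Qed.

(** Each [Xi] has an element outside the other two. Shrinking [Xi] to a cocircuit through that
    element keeps non-inclusion and, as weights are nonnegative, does not raise the total. *)
Lemma cotriple_of_cocycles N mu X1 X2 X3 :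
  {in ground N, forall e, 0 <= mu e} ->
  cocycle N X1 -> cocycle N X2 -> cocycle N X3 -> noninclusion X1 X2 X3 ->
  exists2 C, C \in cotriples N & triple_weight mu C <=
    \sum_(e in X1) mu e + \sum_(e in X2) mu e + \sum_(e in X3) mu e.
Proof.
move=> mu0 h1 h2 h3 /and3P[].
move=> /subsetPn[x1 x11]; rewrite inE negb_or => /andP[x12 x13].
move=> /subsetPn[x2 x22]; rewrite inE negb_or => /andP[x21 x23].
move=> /subsetPn[x3 x33]; rewrite inE negb_or => /andP[x31 x32].
have [C1 [hC1 xC1 s1]] := cocycle_cocircuit h1 x11.
have [C2 [hC2 xC2 s2]] := cocycle_cocircuit h2 x22.
have [C3 [hC3 xC3 s3]] := cocycle_cocircuit h3 x33.
have out x X Y : X \subset Y -> x \notin Y -> x \notin X.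
  by move=> sXY; apply: contra; exact: (subsetP sXY).
exists (C1, C2, C3).
  rewrite inE /= hC1 hC2 hC3 /=; apply/and3P; split; apply/subsetPn;
    [exists x1 | exists x2 | exists x3] => //; rewrite inE negb_or;
    by rewrite !(out _ _ _ s1, out _ _ _ s2, out _ _ _ s3).
have mono X Y : cocycle N Y -> X \subset Y -> \sum_(e in X) mu e <= \sum_(e in Y) mu e.
  by move=> [sY _]; apply: sum_subset => e /(subsetP sY); exact: mu0.
by rewrite /triple_weight !lerD // mono.
Qed.

Lemma sum_symdiff mu X Y : \sum_(e in symdiff X Y) mu e =
  \sum_(e in X) mu e + \sum_(e in Y) mu e - (\sum_(e in X :&: Y) mu e) *+ 2.
Proof.
have d : [disjoint X :\: Y & Y :\: X].
  by rewrite -setI_eq0; apply/eqP/setP => x; rewrite !inE; case: (x \in X); rewrite ?andbF.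
have e1 := @big_setID R 0 +%R _ X Y mu.
have e2 := @big_setID R 0 +%R _ Y X mu.
rewrite /= in e1 e2; rewrite (eq_bigl _ _ (fun e => in_setU e (X :\: Y) (Y :\: X))) bigU //=.
rewrite (setIC Y X) in e2; rewrite e1 e2; lra.
Qed.

(* Exchanging [X2] for [X1 + X2] and/or [X3] for [X1 + X3] restores the
   non-inclusion property, and one of these exchanges does not increase the
   weight. *)
Lemma cotriple_exchange N mu X1 X2 X3 :
  {in ground N, forall e, 0 <= mu e} ->
  cocycle N X1 -> cocycle N X2 -> cocycle N X3 -> X1 != set0 ->
  ~~ (X2 \subset X1 :|: X3) -> ~~ (X3 \subset X1 :|: X2) ->
  exists2 C, C \in cotriples N & triple_weight mu C <=
    \sum_(e in X1) mu e + \sum_(e in X2) mu e + \sum_(e in X3) mu e.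
Proof.
move=> mu0 h1 h2 h3 X1n0 n2 n3.
case: (boolP (X1 \subset X2 :|: X3)) => [s1|n1]; last first.
  by apply: cotriple_of_cocycles => //; apply/and3P.
have /subsetPn[x2 x22] := n2; rewrite inE negb_or => /andP[x21 x23].
have /subsetPn[x3 x33] := n3; rewrite inE negb_or => /andP[x31 x32].
(* Since [X1] is now covered by [X2] and [X3], its weight splits as [r + p + q]. *)
pose p := \sum_(e in (X1 :&: X2) :\: X3) mu e.
pose q := \sum_(e in (X1 :&: X3) :\: X2) mu e.
pose r := \sum_(e in (X1 :&: X2) :&: X3) mu e.
have pos Y : Y \subset X1 -> 0 <= \sum_(e in Y) mu e.
  move=> sY; apply: sumr_ge0 => e eY; apply: mu0.
  by apply: (subsetP h1.1); exact: (subsetP sY).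
have p0 : 0 <= p by apply: pos; rewrite (subset_trans (subsetDl _ _)) ?subsetIl.
have q0 : 0 <= q by apply: pos; rewrite (subset_trans (subsetDl _ _)) ?subsetIl.
have r0 : 0 <= r by apply: pos; rewrite -setIA subsetIl.
have e12 : \sum_(e in X1 :&: X2) mu e = r + p by rewrite (big_setID X3).
have e13 : \sum_(e in X1 :&: X3) mu e = r + q.
  by rewrite (big_setID X2) /= setIAC.
have e1 : \sum_(e in X1) mu e = r + p + q.
  rewrite (big_setID X2) /= e12; congr (_ + _); apply: eq_bigl => e.
  rewrite !inE; case: (boolP (e \in X1)) => //= /(subsetP s1); rewrite inE.
  by case: (e \in X2) => //= ->.
have s12 := sum_symdiff mu X1 X2; have s13 := sum_symdiff mu X1 X3.
rewrite e12 e1 in s12; rewrite e13 e1 in s13.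
have h12 := cocycle_symdiff h1 h2; have h13 := cocycle_symdiff h1 h3.
(* An element common to all three sets leaves both [X1 + X2] and [X1 + X3]. Replacing both sets
   therefore frees [X1], and the total changes by [- 2 r]. *)
case: (boolP ((X1 :&: X2) :&: X3 == set0)) => [/eqP r_0|/set0Pn[x]]; last first.
  rewrite !inE => /andP[/andP[x1 x_2] x_3].
  have [|C hC leC] := cotriple_of_cocycles mu0 h1 h12 h13.
    apply/and3P; split; apply/subsetPn; [exists x | exists x2 | exists x3];
      by rewrite ?inE ?(negPf x21) ?(negPf x23) ?(negPf x31) ?(negPf x32) ?x1 ?x_2 ?x_3 ?x22 ?x33.
  by exists C => //; apply: le_trans leC _; rewrite ?s12 ?s13 e1; lra.
have r_eq0 : r = 0 by rewrite /r r_0 big_set0.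
(* Replacing [X2] alone changes the total by [q - p - r], where [r = 0]; [exQ] is the mirror
   image. *)
have exP : (X1 :&: X2) :\: X3 != set0 -> q <= p ->
  exists2 C, C \in cotriples N & triple_weight mu C <=
    \sum_(e in X1) mu e + \sum_(e in X2) mu e + \sum_(e in X3) mu e.
  move=> /set0Pn[x]; rewrite !inE => /and3P[x_3 x1 x_2] qp.
  have [|C hC leC] := cotriple_of_cocycles mu0 h1 h12 h3.
    apply/and3P; split; apply/subsetPn; [exists x | exists x2 | exists x3];
      by rewrite ?inE ?(negPf x21) ?(negPf x23) ?(negPf x31) ?(negPf x32) ?x1 ?x_2 ?(negPf x_3) ?x22 ?x33.
  by exists C => //; apply: le_trans leC _; rewrite ?s12 ?s13 e1; lra.
have exQ : (X1 :&: X3) :\: X2 != set0 -> p <= q ->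
  exists2 C, C \in cotriples N & triple_weight mu C <=
    \sum_(e in X1) mu e + \sum_(e in X2) mu e + \sum_(e in X3) mu e.
  move=> /set0Pn[x]; rewrite !inE => /and3P[x_2 x1 x_3] qp.
  have [|C hC leC] := cotriple_of_cocycles mu0 h1 h2 h13.
    apply/and3P; split; apply/subsetPn; [exists x | exists x2 | exists x3];
      by rewrite ?inE ?(negPf x21) ?(negPf x23) ?(negPf x31) ?(negPf x32) ?x1 ?(negPf x_2) ?x_3 ?x22 ?x33.
  by exists C => //; apply: le_trans leC _; rewrite ?s12 ?s13 e1; lra.
(* If one of the two remaining pieces of [X1] is empty, its weight is 0 and the other is nonempty
   because [X1] is. If both are nonempty, the comparison of [p] and [q] decides. *)
have [P0|Pn0] := eqVneq ((X1 :&: X2) :\: X3) set0.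
  apply: exQ; last by rewrite [p](_ : _ = 0) // /p P0 big_set0.
  have /set0Pn[x x1] := X1n0; apply/set0Pn; exists x.
  have := subsetP s1 x x1; have := in_set0 x; have := in_set0 x.
  rewrite -{1}r_0 -{1}P0 !inE x1 /=.
  by case: (x \in X2); case: (x \in X3) => //=.
have [Q0|Qn0] := eqVneq ((X1 :&: X3) :\: X2) set0.
  by apply: exP; rewrite // [q](_ : _ = 0) // /q Q0 big_set0.
by have [qp|/ltW pq] := leP q p; [exact: exP | exact: exQ].
Qed.

End TripleWeight.

(** * Comparison of cosystoles; restriction to a transversal of the parallel classes *)

Section Comparison.

Context (R : realType) {T : finType}.
Implicit Types (M N : matroid T) (mu : T -> R) (e f x y : T) (I B C X Y : {set T}).

(** Applied to an optimal [mu] of [M], the transfer gives a weight on [N] whose minimum is at least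
    that of [mu]. *)
Lemma sys3_le M N :
  cotriples M != set0 -> cotriples N != set0 ->
  (forall mu, prob_weight M mu -> exists2 mu', prob_weight N mu' &
    forall D, D \in cotriples N ->
      exists2 C, C \in cotriples M & triple_weight mu C <= triple_weight mu' D) ->
  sys3 R M <= sys3 R N.
Proof.
move=> M0 N0 transfer; have [mu pmu [-> _]] := sys3P R M0.
have [nu _ [-> maxN]] := sys3P R N0.
have [mu' pmu' le'] := transfer mu pmu.
apply: le_trans (maxN mu' pmu').
have [D hD [-> _]] := min_triple_weightP mu' N0.
have [C hC leC] := le' D hD.
exact: le_trans (min_triple_weight_le mu hC) leC.
Qed.

(** The weight is pushed forward along [p]: the new weight of [D] is the old weight of its preimage,
    which contains the lifted cocircuit. *)
Lemma sys3_le_push M N (p : T -> T) :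
  {in ground M, forall e, p e \in ground N} ->
  (forall D, D \in cotriples N -> exists2 C, C \in cotriples M &
    [/\ {in C.1.1, forall e, p e \in D.1.1}, {in C.1.2, forall e, p e \in D.1.2}
      & {in C.2, forall e, p e \in D.2}]) ->
  cotriples N != set0 -> sys3 R M <= sys3 R N.
Proof.
move=> pMN pC N0; have [D0 hD0] := set0Pn _ N0; have [C0 hC0 _] := pC D0 hD0.
apply: sys3_le => //; first by apply/set0Pn; exists C0.
move=> mu [mu0 mu1]; exists (fun x => \sum_(e in ground M | p e == x) mu e).
  split=> [x _|]; first by apply: sumr_ge0 => e /andP[/mu0].
  by rewrite -mu1 [RHS](partition_big p (mem (ground N))).
move=> D hD; have [C hC [p1 p2 p3]] := pC D hD; exists C => //.
have le X Y : X \subset ground M -> {in X, forall e, p e \in Y} ->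
    \sum_(e in X) mu e <= \sum_(x in Y) \sum_(e in ground M | p e == x) mu e.
  move=> sX pXY; have -> : \sum_(x in Y) \sum_(e in ground M | p e == x) mu e =
      \sum_(e in [set e in ground M | p e \in Y]) mu e.
    rewrite [RHS](partition_big p (mem Y)) /=; last by move=> e; rewrite inE => /andP[].
    apply: eq_bigr => x xY; apply: eq_bigl => e; rewrite inE.
    by case: (eqVneq (p e) x) => [->|_]; rewrite ?andbF //= xY !andbT.
  apply: sum_subset => [e|]; first by rewrite inE => /andP[/mu0].
  by apply/subsetP => e eX; rewrite inE pXY // (subsetP sX).
move: hC; rewrite inE => /and4P[h1 h2 h3 _].
by rewrite /triple_weight !lerD // le // cocircuit_ground.
Qed.

(** Cocircuits of [M / e] avoid [e], so the weight of [e] may be moved to an arbitrary element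
    [e0]. *)
Lemma sys3_contract M e : e \in ground M ->
  cotriples (mcontract M [set e]) != set0 ->
  sys3 R M <= sys3 R (mcontract M [set e]).
Proof.
move=> eM N0; have [e0 e0N] := ground_neq0 N0.
apply: (@sys3_le_push _ _ (fun x => if x == e then e0 else x)) => // [x xM|D].
  by case: eqVneq => // nxe; rewrite !inE nxe.
rewrite inE !cocircuit_contract => /and4P[/andP[h1 e1] /andP[h2 e2] /andP[h3 e3] hD].
exists D; first by rewrite inE h1 h2 h3.
by split=> x xD; case: eqVneq => // exe; rewrite exe (negPf e1, negPf e2, negPf e3) in xD.
Qed.

(** The witnesses [x1], [x2], [x3] of non-inclusion are distinct, so deleting [e] destroys at most
    one. The cocircuit that loses its witness takes the first place in [cotriple_exchange], which
    asks only that it be nonempty. *)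
Lemma cotriple_delete M e mu (C : {set T} * {set T} * {set T}) :
  (forall C, cocircuit M C -> cocycle M C) -> ~~ coloop M e ->
  {in ground M, forall e, 0 <= mu e} -> C \in cotriples M ->
  exists2 D, D \in cotriples (mdelete M [set e]) &
    triple_weight mu D <= triple_weight mu C.
Proof.
move=> binM ncl mu0; case: C => -[C1 C2] C3; rewrite inE /=.
move=> /and4P[h1 h2 h3 /and3P[n1 n2 n3]].
have y1 := cocycle_delete e (binM _ h1).
have y2 := cocycle_delete e (binM _ h2).
have y3 := cocycle_delete e (binM _ h3).
(* A cocircuit contained in the singleton of [e] would make [e] a coloop. *)
have nz C : cocircuit M C -> C :\ e != set0.
  move=> hC; apply/negP => /eqP C0.
  have := cocircuit_neq0 hC; have : C \subset [set e] by rewrite -setD_eq0 C0.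
  by rewrite subset1 => /orP[/eqP eC _|->//]; rewrite /coloop /loop -eC in ncl; rewrite [circuit _ _]hC in ncl.
have mu0N : {in ground (mdelete M [set e]), forall e, 0 <= mu e}.
  by move=> x; rewrite inE => /andP[_]; exact: mu0.
have mono C : cocircuit M C -> \sum_(x in C :\ e) mu x <= \sum_(x in C) mu x.
  move=> hC; apply: sum_subset; last exact: subsetDl.
  move=> x.  by move/(subsetP (cocircuit_ground hC)); exact: mu0.
have m1 := mono _ h1; have m2 := mono _ h2; have m3 := mono _ h3.
have del X Y Z x : x \in X -> x \notin Y :|: Z -> x != e ->
    ~~ (X :\ e \subset (Y :\ e) :|: (Z :\ e)).
  by move=> xX xYZ nxe; apply/subsetPn; exists x; rewrite !inE nxe //= -in_setU.
have /subsetPn[x1 x11 x1n] := n1; have /subsetPn[x2 x22 x2n] := n2.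
have /subsetPn[x3 x33 x3n] := n3.
have x12 : x1 != x2 by apply: contraNneq x1n => ->; rewrite inE x22.
have x13 : x1 != x3 by apply: contraNneq x1n => ->; rewrite inE x33 orbT.
have x23 : x2 != x3 by apply: contraNneq x2n => ->; rewrite inE x33 orbT.
have d1 := del _ _ _ _ x11 x1n; have d2 := del _ _ _ _ x22 x2n.
have d3 := del _ _ _ _ x33 x3n; rewrite /triple_weight /=.
have [e2|ne2] := eqVneq x2 e.
  rewrite e2 in x12 x23.
  have [||D hD leD] := cotriple_exchange mu0N y2 y1 y3 (nz _ h2).
  - exact: d1 x12.
  - by rewrite setUC d3 1?eq_sym.
  by exists D => //; rewrite /triple_weight in leD; lra.
have [e3|ne3] := eqVneq x3 e.
  rewrite e3 in x13.
  have [||D hD leD] := cotriple_exchange mu0N y3 y1 y2 (nz _ h3).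
  - by rewrite setUC d1.
  - by rewrite setUC d2.
  by exists D => //; rewrite /triple_weight in leD; lra.
(* The remaining case, whether or not [x1] is [e]. *)
have [D hD leD] := cotriple_exchange mu0N y1 y2 y3 (nz _ h1) (d2 ne2) (d3 ne3).
by exists D => //; rewrite /triple_weight in leD; lra.
Qed.

Lemma sys3_delete M e :
  (forall C, cocircuit M C -> cocycle M C) -> e \in ground M -> ~~ coloop M e ->
  cotriples M != set0 -> sys3 R (mdelete M [set e]) <= sys3 R M.
Proof.
move=> binM eM ncl M0; apply: sys3_le => //.
  have [C hC] := set0Pn _ M0.
  (* The zero weight serves only to obtain a triple of [M \ e]. *)
  have [|D hD _] := cotriple_delete (mu := fun=> 0) binM ncl _ hC; first by [].
  by apply/set0Pn; exists D.
(* The value of [mu] at [e] is arbitrary, since [e] is outside the ground set of [M \ e]; it is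
   reset to 0. *)
move=> mu [mu0 mu1]; pose mu' x := if x == e then 0 else mu x.
have mu'0 : {in ground M, forall x, 0 <= mu' x}.
  by move=> x xM; rewrite /mu'; case: eqVneq => // nxe; apply: mu0; rewrite !inE nxe.
exists mu'.
  split=> //; rewrite -mu1 (big_setID [set e]) /= big1 ?add0r; last first.
    by move=> x; rewrite !inE /mu' => /andP[_ ->].
  by apply: eq_bigr => x; rewrite !inE /mu' => /andP[/negPf->].
move=> C hC; have [D hD leD] := cotriple_delete binM ncl mu'0 hC.
exists D => //; rewrite (@triple_weight_eq _ _ _ mu mu' D hD) // => x.
by rewrite !inE /mu' => /andP[/negPf->].
Qed.

End Comparison.

(** * Parallel elements and the cocircuits of a restriction *)

Section Simplification.

Context {T : finType}.
Implicit Types (M N : matroid T) (e f x y : T) (I B C D X : {set T}).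

(** A maximal independent subset [K] of [f |: I] through [f] is at least as large as [I] and cannot
    contain [e]; counting leaves only [f |: I :\ e]. *)
Lemma indep_swap M I e f : I \in indep M -> e \in I ->
  e \in nonloops M -> f \in nonloops M -> parallel M e f -> e != f ->
  f \notin I /\ f |: I :\ e \in indep M.
Proof.
move=> hI eI eM fM; rewrite parallelE // => + /negPf nef; rewrite nef /= => hef.
have dep J : J \in indep M -> f \in J -> e \notin J.
  move=> hJ fJ; apply: contra hef => eJ; apply: indep_sub hJ _.
  by rewrite subUset !sub1set eJ.
have fI : f \notin I by apply/negP => /(dep I hI); rewrite eI.
split=> //; have [B0 hB0 sIB0] := indep_basis hI.
have hf : [set f] \in indep M by rewrite -nonloopE.
have [K [hK cK fK]] : exists K, [/\ K \in indep M, #|I| <= #|K| & f \in K /\ K \subset f |: I]%N.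
  have Pf : ([set f] \in indep M) && ([set f] \subset f |: I) by rewrite hf subsetUl.
  have [K /maxsetP[/andP[hK sK] maxK] fK] := maxset_exists
    (P := fun K : {set T} => (K \in indep M) && (K \subset f |: I)) Pf.
  exists K; split=> //; last by rewrite sub1set in fK.
  rewrite leqNgt; apply/negP => /(indep_aug hK hI)[x /setDP[xI xK] hx].
  move: xK; rewrite -(maxK (x |: K)) ?setU11 ?subsetUr // hx subUset sK sub1set.
  by rewrite inE xI orbT.
move: fK => [fK sK]; suff -> : f |: I :\ e = K by [].
apply/esym/eqP; rewrite eqEcard; apply/andP; split.
  apply/subsetP => x xK; have := subsetP sK x xK; rewrite !inE.
  case: (eqVneq x e) => [exe|//]; have := dep K hK fK.
  by rewrite -exe xK.
by rewrite cardsU1 !inE (negPf fI) andbF add1n (leq_trans _ cK) // [X in (_ <= X)%N](cardsD1 e) eI.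
Qed.

(** Take a basis meeting [C] in [e] only. As [f] can replace [e] in it, [f] lies in the fundamental
    cocircuit of [e], which is [C]. *)
Lemma cocircuit_parallel M C e f : cocircuit M C -> e \in C ->
  e \in nonloops M -> f \in nonloops M -> parallel M e f -> f \in C.
Proof.
move=> hC eC eM fM ef; have [<- //|nef] := eqVneq e f.
have /cocircuitP[_ _ /(_ e eC)[B hB BC]] := hC.
have eB : e \in B by have := set11 e; rewrite -BC inE => /andP[].
have [fB hf] := indep_swap (basis_indep hB) eB eM fM ef nef.
rewrite (cocircuit_fundamental hC hB BC) inE hf !inE (negPf fB) andbF /= andbT.
by move: fM; rewrite inE => /andP[].
Qed.

Lemma cocircuit_nonloops M C : cocircuit M C -> C \subset nonloops M.
Proof.
move=> hC; apply/subsetP => e eC; have /cocircuitP[_ _ /(_ e eC)[B hB BC]] := hC.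
rewrite nonloopE; apply: indep_sub (basis_indep hB) _.
by rewrite sub1set; have := set11 e; rewrite -BC inE => /andP[].
Qed.

Section Restriction.

Variables (M : matroid T) (X : {set T}).
Hypothesis sX : X \subset nonloops M.
Hypothesis hX : {in nonloops M, forall e, exists2 f, f \in X & parallel M e f}.

Let N := mdelete M (ground M :\: X).

Lemma restrict_indep I : (I \in indep N) = (I \in indep M) && (I \subset X).
Proof.
rewrite inE; case: (boolP (I \in indep M)) => //= hI; apply/idP/idP => [d|sI].
  apply/subsetP => x xI; have := disjointFr d xI; rewrite inE.
  by rewrite (subsetP (indep_ground hI)) // andbT => /negbFE.
by rewrite (disjointWl sI) // -setI_eq0 setIDA setIC setDIl setDv setI0.
Qed.

Lemma restrict_ground : ground N = X.
Proof.
rewrite /= setDDr setDv set0U; apply/setIidPr/(subset_trans sX).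
by apply/subsetP => e; rewrite inE => /andP[].
Qed.

(** Elements of [B] outside [X] are swapped one at a time for parallel ones in [X]. [C] contains
    both or neither of the swapped elements, so it still meets the basis once. *)
Lemma basis_restrict C x B : cocircuit M C -> basis M B -> B :&: C = [set x] ->
  exists B' x', [/\ basis M B', B' \subset X & B' :&: C = [set x']].
Proof.
move=> hC; have [n] := ubnP #|B :\: X|; elim: n B x => // n IH B x ltn hB BC.
have [/eqP|/set0Pn[b]] := boolP (B :\: X == set0).
  by move/eqP; rewrite setD_eq0 => sBX; exists B, x.
rewrite inE => /andP[bX bB].
have bM : b \in nonloops M.
  by rewrite nonloopE; apply: indep_sub (basis_indep hB) _; rewrite sub1set.
have [f fX bf] := hX bM; have fM := subsetP sX f fX.
have nbf : b != f by apply: contraNneq bX => ->.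
have [fB hf] := indep_swap (basis_indep hB) bB bM fM bf nbf.
have hB' : basis M (f |: B :\ b).
  apply: card_basis hB hf _; rewrite cardsU1 !inE (negPf fB) andbF.
  by rewrite (cardsD1 b B) bB.
have fC : (f \in C) = (b \in C).
  apply/idP/idP => [fC|bC]; last exact: (cocircuit_parallel hC bC bM fM bf).
  apply: (cocircuit_parallel hC fC fM bM).
  by rewrite /parallel eq_sym setUC.
(* If the removed [b] lies in [C], it is the common element [x], and [f] takes its place. *)
apply: (IH _ (if b \in C then f else x) _ hB').
  apply: leq_trans (_ : #|B :\: X| <= n)%N => //; apply: proper_card.
  apply/properP; split.
    apply/subsetP => y; rewrite !inE => /andP[yX /orP[/eqP eyf|/andP[_ ->]]].
      by rewrite eyf fX in yX.
    by rewrite yX.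
  by exists b; rewrite !inE ?bX //= (negPf nbf) eqxx.
apply/setP => y; rewrite !inE.
have /setP/(_ y) := BC; have /setP/(_ b) := BC; rewrite !inE bB /=.
case: (eqVneq y f) => [->|nyf] /=.
  by rewrite fC (negPf fB); case: (b \in C) => _ /=; rewrite ?eqxx // => <-.
case: (boolP (b \in C)) => [bC /esym/eqP <-|bC _] /=.
  by rewrite (negPf nyf); case: (eqVneq y b) => //= _.
case: (eqVneq y b) => //= ->; by rewrite (negPf bC) andbF.
Qed.

(** As [X] contains a basis of [M], the bases of [N] are those of [M] inside [X], and fundamental
    cocircuits for them are traces on [X]. By [basis_restrict] every cocircuit of [M] is fundamental
    for such a basis. *)
Lemma cocircuit_restrictP D : cocircuit N D <-> exists2 C, cocircuit M C & D = C :&: X.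
Proof.
have [B0 hB0 sB0] : exists2 B, basis M B & B \subset X.
  have [B hB] := basis_exists M.
  have [B0|/set0Pn[x xB]] := eqVneq B set0; first by exists B; rewrite // B0 sub0set.
  have [B' [x' [hB' sB' _]]] :=
    basis_restrict (fundamental_cocircuitP hB xB) hB (fundamental_cocircuitI hB xB).
  by exists B'.
have hB0N : basis N B0.
  apply/maxsetP; rewrite restrict_indep basis_indep //; split=> [//|J].
  by rewrite restrict_indep => /andP[hJ _] sJ; have /maxsetP[_] := hB0; apply.
have basisN B : basis N B <-> basis M B /\ B \subset X.
  split=> [hB|[hB sB]].
    have := basis_indep hB; rewrite restrict_indep => /andP[hBM sB]; split=> //.
    apply: (card_basis hB0 hBM); apply/eqP; rewrite eqn_leq (leq_basis hB0) //.
    by rewrite (leq_basis hB) // basis_indep.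
  apply: (card_basis hB0N); first by rewrite restrict_indep basis_indep.
  by apply/eqP; rewrite eqn_leq (leq_basis hB0) ?(leq_basis hB) ?basis_indep.
have fundN B x : B \subset X ->
    fundamental_cocircuit N B x = fundamental_cocircuit M B x :&: X.
  move=> sB; apply/setP => y; rewrite [LHS]inE restrict_ground restrict_indep subUset sub1set.
  rewrite (subset_trans (subsetDl _ _) sB) andbT !inE.
  have [yX|] := boolP (y \in X); rewrite ?andbF //= !andbT.
  by have := subsetP sX y yX; rewrite inE => /andP[->].
split=> [hD|[C hC ->]].
  have [x xD] := set0Pn _ (cocircuit_neq0 hD).
  have /cocircuitP[_ _ /(_ x xD)[B hB BD]] := hD.
  have [hBM sB] := (basisN B).1 hB.
  exists (fundamental_cocircuit M B x).
    by apply: fundamental_cocircuitP => //; have := set11 x; rewrite -BD inE => /andP[].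
  by rewrite -fundN //; exact: cocircuit_fundamental.
have [x xC] := set0Pn _ (cocircuit_neq0 hC).
have /cocircuitP[_ _ /(_ x xC)[B hB BC]] := hC.
have [B' [x' [hB' sB' BC']]] := basis_restrict hC hB BC.
rewrite (cocircuit_fundamental hC hB' BC') -fundN //.
apply: fundamental_cocircuitP; first exact/basisN.
by have := set11 x'; rewrite -BC' inE => /andP[].
Qed.

End Restriction.

End Simplification.

(** * The cosystole of the simplification *)

Section SimplificationSystole.

Context (R : realType) {T : finType}.
Implicit Types (M N : matroid T) (e f x y : T) (C D X : {set T}).

Lemma transversal_parallel M X :
  is_transversal X (parallel_classes M) (nonloops M) ->
  X \subset nonloops M /\
  {in nonloops M, forall e, exists2 f, f \in X & parallel M e f}.
Proof.
case/and3P=> hP sX /forall_inP hX; split=> // e eM.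
have eP : e \in cover (parallel_classes M) by rewrite (cover_partition hP).
have /cards1P[f Xf] := hX _ (pblock_mem eP).
have := set11 f; rewrite -Xf inE => /andP[fX]; exists f => //.
by rewrite -(pblock_equivalence_partition (@parallel_equiv _ M)) // (subsetP sX).
Qed.

Lemma parallel_sym M e f : parallel M e f = parallel M f e.
Proof. by rewrite /parallel eq_sym setUC. Qed.

(** Weights are pushed forward both ways: by the identity from [X] to [M], and from [M] to [X] by
    sending each nonloop to a parallel element of [X]. *)
Lemma sys3_simplification M N : simplification M N -> cotriples M != set0 ->
  sys3 R M = sys3 R N.
Proof.
move=> [X /transversal_parallel[sX hX] ->]; set N0 := mdelete _ _ => M0.
have gN : ground N0 = X := restrict_ground sX.
have coP D := cocircuit_restrictP sX hX D.
have trace C x : cocircuit M C -> x \in nonloops M -> x \notin C ->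
    forall f, f \in X -> parallel M x f -> f \notin C.
  move=> hC xM xC f fX xf; apply: contra xC => fC.
  by apply: (cocircuit_parallel hC fC (subsetP sX f fX) xM); rewrite parallel_sym.
(* A witness of non-inclusion is moved to its parallel representative; cocircuits are unions of
   parallel classes. *)
have sub C1 C2 C3 : cocircuit M C1 -> cocircuit M C2 -> cocircuit M C3 ->
    ~~ (C1 \subset C2 :|: C3) -> ~~ (C1 :&: X \subset (C2 :&: X) :|: (C3 :&: X)).
  move=> h1 h2 h3 /subsetPn[x x1]; rewrite inE negb_or => /andP[x2 x3].
  have xM := subsetP (cocircuit_nonloops h1) x x1.
  have [f fX xf] := hX x xM; apply/subsetPn; exists f.
    by rewrite inE fX (cocircuit_parallel h1 x1 xM (subsetP sX f fX)).
  rewrite !inE fX !andbT negb_or.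
  by rewrite (trace _ _ h2 xM x2 f) // (trace _ _ h3 xM x3 f).
have restrict (C : {set T} * {set T} * {set T}) : C \in cotriples M ->
    (C.1.1 :&: X, C.1.2 :&: X, C.2 :&: X) \in cotriples N0.
  rewrite !inE /= => /and4P[h1 h2 h3 /and3P[n1 n2 n3]].
  apply/and4P; split; try by apply/coP; eexists; last reflexivity.
  by apply/and3P; split; apply: sub.
have N0n0 : cotriples N0 != set0.
  by have [C /restrict hC] := set0Pn _ M0; apply/set0Pn; eexists; exact: hC.
have sXM : X \subset ground M.
  by apply: subset_trans sX _; apply/subsetP => e; rewrite inE => /andP[].
apply/eqP; rewrite eq_le; apply/andP; split; last first.
  apply: (@sys3_le_push _ _ _ _ id) => // [e|C hC].
    by rewrite gN => /(subsetP sXM).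
  by eexists; [exact: restrict hC | split=> e; rewrite inE => /andP[]].
have [x0 x0N] := ground_neq0 N0n0; rewrite gN in x0N.
(* Loops go to the arbitrary [x0], which is harmless since no cocircuit contains a loop. For
   nonloops the default of [odflt] is never reached. *)
pose p e := if e \in nonloops M then odflt x0 [pick f in X | parallel M e f] else x0.
have pX e : p e \in X.
  by rewrite /p; case: ifP => // _; case: pickP => // f /andP[].
have pp e : e \in nonloops M -> parallel M e (p e).
  move=> eM; rewrite /p eM; case: pickP => [f /andP[] //|/= no].
  by have [f fX ef] := hX e eM; have := no f; rewrite fX ef.
have pC C : cocircuit M C -> {in C, forall e, p e \in C :&: X}.
  move=> hC e eC; have eM := subsetP (cocircuit_nonloops hC) e eC.
  by rewrite inE pX (cocircuit_parallel hC eC eM (subsetP sX _ (pX e)) (pp e eM)).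
apply: (@sys3_le_push _ _ _ _ p) => // [e _|]; first by rewrite gN.
move=> [[D1 D2] D3]; rewrite inE /=.
move=> /and4P[/coP[C1 h1 ->] /coP[C2 h2 ->] /coP[C3 h3 ->] /and3P[n1 n2 n3]].
exists (C1, C2, C3); last by split=> /= e; exact: pC.
rewrite inE /= h1 h2 h3 /=; apply/and3P; split.
- by apply: contra n1 => s; rewrite -setIUl setSI.
- by apply: contra n2 => s; rewrite -setIUl setSI.
- by apply: contra n3 => s; rewrite -setIUl setSI.
Qed.

End SimplificationSystole.

(** * Regular matroids are binary *)

Section LinearlyFree.

Variables (F : fieldType) (K : finType) (m : nat) (w : K -> 'rV[F]_m).
Implicit Types (I : {set K}) (c : K -> F).

Definition free_family I : bool := row_free (\matrix_(i < #|I|) w (enum_val i)).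

Lemma free_familyP I :
  free_family I <->
  (forall c, \sum_(x in I) c x *: w x = 0 -> {in I, forall x, c x = 0}).
Proof.
have sumE (v : 'rV_#|I|) : v *m (\matrix_(i < #|I|) w (enum_val i)) =
    \sum_(i < #|I|) v 0 i *: w (enum_val i).
  by rewrite mulmx_sum_row; apply: eq_bigr => i _; rewrite rowK.
split=> [hI c c0 x xI|hI].
  have : (\row_i c (enum_val i)) *m (\matrix_(i < #|I|) w (enum_val i)) == 0.
    apply/eqP; rewrite sumE; apply: etrans c0; rewrite [RHS]big_enum_val.
    by apply: eq_bigr => i _; rewrite mxE.
  rewrite mulmx_free_eq0 // => /eqP/rowP/(_ (enum_rank_in xI x)).
  by rewrite !mxE enum_rankK_in.
apply: inj_row_free => v; rewrite sumE => v0; apply/rowP => i; rewrite mxE.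
(* Coefficients on indices become a function on [K]; at an element of [I] the sum has exactly one
   term. *)
have := hI (fun x => \sum_(j | enum_val j == x) v 0 j) _ (enum_val i) (enum_valP i).
rewrite (big_pred1 i); last by move=> j; rewrite (inj_eq enum_val_inj).
apply; apply: etrans v0; rewrite big_enum_val; apply: eq_bigr => j _.
by rewrite (big_pred1 j) // => k; rewrite (inj_eq enum_val_inj).
Qed.

(** A matrix with independent rows has a right inverse, whose column at [x] is the coordinate
    functional of [x]. *)
Lemma free_family_dual I x : free_family I -> x \in I ->
  exists u : 'cV[F]_m, {in I, forall y, (w y *m u) 0 0 = (y == x)%:R}.
Proof.
move=> hI xI; pose A := \matrix_(i < #|I|) w (enum_val i).
exists (col (enum_rank_in xI x) (pinvmx A)) => y yI.
have := mulmxVp hI; rewrite -/A => /matrixP/(_ (enum_rank_in xI y) (enum_rank_in xI x)).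
rewrite [RHS]mxE (inj_in_eq (can_in_inj (enum_rankK_in xI))) // => <-.
rewrite !mxE; apply: eq_bigr => k _; rewrite [in RHS]mxE.
by rewrite enum_rankK_in // mxE.
Qed.

End LinearlyFree.

Lemma F2_neq0 (c : 'F_2) : c != 0 -> c = 1.
Proof. by case: c => -[|[|k]] hk // _; apply/val_inj. Qed.

Lemma F2_nat_eq0 n : ((n%:R : 'F_2) == 0) = ~~ odd n.
Proof. by rewrite -(dvdn_pcharf (pchar_Fp (isT : prime 2))) dvdn2. Qed.

Section Binary.

Context {T : finType}.
Implicit Types (M : matroid T) (x y : T) (B C D I : {set T}).

(** A functional [v] that is 1 at [x] and 0 on the rest of a basis has support [D] on the ground
    set. Over the two-element field a circuit is a relation with all coefficients 1, so applying [v]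
    shows that [#|C :&: D|] is even. *)
Lemma binary_cocircuit_cocycle M m (w : T -> 'rV['F_2]_m) :
  (forall I, I \subset ground M -> (I \in indep M) = free_family w I) ->
  forall D, cocircuit M D -> cocycle M D.
Proof.
move=> hw D hD; split=> [|C hC]; first exact: cocircuit_ground.
have free I : I \in indep M -> free_family w I.
  by move=> hI; rewrite -hw // (indep_ground hI).
have dep I : I \subset ground M -> I \notin indep M ->
    exists c, \sum_(y in I) c y *: w y = 0 /\ exists2 y, y \in I & c y != 0.
  move=> sI hI; apply: boolp.contrapT => no.
  move: hI; rewrite hw // => /negP; apply; apply/free_familyP => c c0 y yI.
  apply/eqP/negPn/negP => cy; by apply: no; exists c; split=> //; exists y.
have [x xD] := set0Pn _ (cocircuit_neq0 hD).
have /cocircuitP[_ _ /(_ x xD)[B hB BD]] := hD.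
have xB : x \in B by have := set11 x; rewrite -BD inE => /andP[].
have [u hu] := free_family_dual (free _ (basis_indep hB)) xB.
pose v y := (w y *m u) 0 0.
have vsum I c : \sum_(y in I) c y *: w y = 0 -> \sum_(y in I) c y * v y = 0.
  move=> c0; have: ((\sum_(y in I) c y *: w y) *m u) 0 0 = 0 by rewrite c0 mul0mx mxE.
  rewrite mulmx_suml summxE; apply: etrans; apply: eq_bigr => y _.
  by rewrite -scalemxAl mxE.
have vB c I : I \subset B :\ x -> \sum_(y in I) c y * v y = 0.
  move=> sI; apply: big1 => y /(subsetP sI); rewrite !inE => /andP[nyx yB].
  by rewrite /v hu // (negPf nyx) mulr0.
have hv y : y \in ground M -> v y = (y \in D)%:R.
  move=> yM; rewrite (cocircuit_fundamental hD hB BD) inE yM /=.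
  have [yB|yB] := boolP (y \in B).
    rewrite /v hu // !inE yB andbT negbK; case: eqVneq => //= ->.
    by rewrite setD1K ?basis_indep.
  have yBx : y \notin B :\ x by rewrite inE negb_and yB orbT.
  have sBx : B :\ x \subset B := subsetDl _ _.
  rewrite yBx /=.
  (* A nontrivial relation on [y |: I] must involve [y], since [I] is free. *)
  have nc I c : I \subset B -> \sum_(z in y |: I) c z *: w z = 0 ->
      (exists2 z, z \in y |: I & c z != 0) -> c y != 0.
    move=> sI c0 [z zI cz]; apply/negP => /eqP cy0.
    have yI : y \notin I by apply: contra yB; exact: (subsetP sI).
    move: c0; rewrite big_setU1 //= cy0 scale0r add0r.
    have /free_familyP hI := free _ (indep_sub (basis_indep hB) sI).
    move: zI; rewrite !inE => /orP[/eqP zy _|zI /hI/(_ z zI) c0].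
      by rewrite zy cy0 eqxx in cz.
    by rewrite c0 eqxx in cz.
  have [hy|hy] := boolP (_ \in indep M).
    have hyB : y |: B \notin indep M.
      by apply/negP => /(leq_basis hB); rewrite cardsU1 yB ltnn.
    have syB : y |: B \subset ground M by rewrite subUset sub1set yM basis_ground.
    have [c [c0 cn0]] := dep _ syB hyB.
    have cy := nc B c (subxx B) c0 cn0.
    (* If [v y] were 0, applying [v] would kill the coefficient of [x], leaving a relation on the
       independent set [y |: B :\ x]. *)
    apply: F2_neq0; apply: contraNneq cy => vy0.
    have := vsum _ _ c0; rewrite big_setU1 //= vy0 mulr0 add0r (big_setD1 x) //=.
    rewrite vB // addr0 /v hu // eqxx mulr1 => cx0.
    have /free_familyP hI := free _ hy; apply/eqP/(hI c); last exact: setU11.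
    by apply: etrans c0; rewrite !big_setU1 //= (big_setD1 x xB) /= cx0 scale0r add0r.
  (* Otherwise [w y] is spanned by [B :\ x], where [v] vanishes. *)
  have syB : y |: B :\ x \subset ground M.
    by rewrite subUset sub1set yM (subset_trans sBx) ?basis_ground.
  have [c [c0 cn0]] := dep _ syB hy.
  have cy := nc _ c sBx c0 cn0.
  have := vsum _ _ c0; rewrite big_setU1 //= vB // addr0 => /eqP.
  by rewrite mulf_eq0 (negPf cy) => /eqP.
have /minsetP[/andP[sC nC] minC] := hC.
have [c [c0 [z zC cz]]] := dep C sC nC.
(* The support of the relation is dependent, hence all of the circuit. *)
have S_C : [set y in C | c y != 0] = C.
  apply: minC; last by apply/subsetP => y; rewrite inE => /andP[].
  have sS : [set y in C | c y != 0] \subset ground M.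
    by apply: subset_trans sC; apply/subsetP => y; rewrite inE => /andP[].
  rewrite sS hw //; apply/negP => /free_familyP/(_ c) hS.
  suff c0S : \sum_(y in [set y in C | c y != 0]) c y *: w y = 0.
    by have := cz; rewrite (hS c0S z) ?eqxx // inE zC.
  apply: etrans c0; rewrite [RHS](bigID (fun y => c y == 0)) /= [X in _ = X + _]big1 ?add0r; last first.
    by move=> y /andP[_ /eqP ->]; rewrite scale0r.
  by apply: eq_bigl => y; rewrite inE.
have := vsum _ _ c0.
have -> : \sum_(y in C) c y * v y = #|C :&: D|%:R.
  rewrite -sumr_const [RHS](eq_bigl (fun y => (y \in C) && (y \in D))); last first.
    by move=> y; rewrite inE.
  rewrite big_mkcondr; apply: eq_bigr => y yC; rewrite hv ?(subsetP sC) //.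
  have := yC; rewrite -{1}S_C inE => /andP[_ /F2_neq0 ->]; rewrite mul1r.
  by case: (y \in D).
by move/eqP; rewrite F2_nat_eq0.
Qed.

End Binary.

(** * Reduction of totally unimodular matrices modulo 2 *)

Section Reduction.

Lemma row_full_minorP (F : fieldType) m k (K : 'M[F]_(m, k)) :
  row_full K <-> exists2 f : 'I_k -> 'I_m, injective f & \det (rowsub f K) != 0.
Proof.
split=> [hK|[f _ hf]].
  exists (fullrankfun hK); first exact: fullrankfun_inj.
  by rewrite -unitfE -unitmxE fullrowsub_unit.
rewrite -sub1mx; apply: submx_trans (rowsub_sub f K).
by rewrite sub1mx row_full_unit unitmxE unitfE.
Qed.

(* The minors of a totally unimodular matrix are 0, 1 or -1, so that they vanish
   if and only if they are even. *)
Lemma totally_unimodular_mod2 m n (A : 'M[rat]_(m, n)) :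
  totally_unimodular A ->
  exists B : 'M['F_2]_(m, n), forall k (g : 'I_k -> 'I_n), injective g ->
    row_free (colsub g A)^T = row_free (colsub g B)^T.
Proof.
move=> tuA; pose Z := map_mx numq A.
have AZ : A = map_mx intr Z.
  apply/matrixP => i j; rewrite !mxE.
  (* Entries are minors of order 1, hence 0, 1 or -1, so [A] comes from an integer matrix. *)
  have := tuA 1%N (fun=> i) (fun=> j) _ _; rewrite det_mx11 mxE.
  have inj (K : Type) (a : K) : injective (fun _ : 'I_1 => a) by move=> x y _; rewrite !ord1.
  by move/(_ (inj _ _) (inj _ _)); rewrite !inE => /or3P[]/eqP->.
exists (map_mx intr Z) => k g ig.
rewrite /row_free !mxrank_tr -!/(row_full _).
have minor f : injective f ->
    (\det (rowsub f (colsub g A)) == 0) = (\det (rowsub f (colsub g (map_mx intr Z : 'M['F_2]_(m, n)))) == 0).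
  move=> jf; have := tuA k f g jf ig; rewrite -!mxsub_comp.
  rewrite AZ -!map_mxsub !det_map_mx /=.
  set z := \det _; rewrite !inE => hz.
  have : [|| z == 0, z == 1 | z == -1].
    by rewrite -!(eqr_int rat).
  by case/or3P=> /eqP->.
apply/idP/idP => /row_full_minorP[f jf hf]; apply/row_full_minorP; exists f => //.
  by rewrite -minor.
by rewrite minor.
Qed.

Lemma regular_binary (T : finType) (M : matroid T) : regular_matroid M ->
  exists m (w : T -> 'rV['F_2]_m),
    forall I : {set T}, I \subset ground M -> (I \in indep M) = free_family w I.
Proof.
move=> [m [A [/totally_unimodular_mod2[B AB] repA]]].
(* The vector of [e] is its column modulo 2; the sum has one term on the ground set and is 0
   elsewhere. *)
exists m, (fun e => \sum_(j | enum_val j == e) row j B^T) => I sI.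
pose J := [set j : 'I_#|ground M| | enum_val j \in I].
have eI : [set enum_val j | j in J] = I.
  apply/setP => e; apply/imsetP/idP => [[j] |eI]; first by rewrite inE => jI ->.
  have eM := subsetP sI e eI; exists (enum_rank_in eM e); last by rewrite enum_rankK_in.
  by rewrite inE enum_rankK_in.
rewrite -{1}eI repA AB; last exact: enum_val_inj.
have -> : (colsub (@enum_val _ (mem J)) B)^T =
    \matrix_(i < #|J|) row (enum_val i) B^T by apply/matrixP => i j; rewrite !mxE.
rewrite -/(free_family (fun j => row j B^T) J).
have wE j : \sum_(k | enum_val k == enum_val j) row k B^T = row j B^T.
  by rewrite (big_pred1 j) // => k; rewrite (inj_eq enum_val_inj).
have sumE c : \sum_(e in I) c e *: (\sum_(k | enum_val k == e) row k B^T) =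
    \sum_(j in J) c (enum_val j) *: row j B^T.
  rewrite -eI big_imset /=; last by move=> j k _ _; exact: enum_val_inj.
  by apply: eq_bigr => j _; rewrite wE.
apply/idP/idP => /free_familyP free; apply/free_familyP => c c0.
  move=> e; rewrite -eI => /imsetP[j jJ ->].
  by apply: (free (c \o enum_val)) => //=; rewrite -sumE.
move=> j jJ; pose d e := \sum_(k | enum_val k == e) c k.
have dE k : d (enum_val k) = c k.
  by rewrite /d (big_pred1 k) // => l; rewrite (inj_eq enum_val_inj).
rewrite -dE; apply: free; last by rewrite inE in jJ.
by rewrite sumE; under eq_bigr do rewrite dE.
Qed.

End Reduction.

Theorem theorem2 (R : realType) (T : finType) (M : matroid T)
  (regM : regular_matroid M) :
  (forall e : T, e \in ground M -> ~~ coloop M e ->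
     (3 <= rk (mcontract M [set e]) (ground (mcontract M [set e])))%N ->
     sys3 R (mdelete M [set e]) <= sys3 R M /\
     sys3 R M <= sys3 R (mcontract M [set e])) /\
  (forall N : matroid T, simplification M N -> cotriples M != set0 ->
     sys3 R M = sys3 R N).
Proof.
split=> [e eM ncl /cotriples_rk N0|N sN M0]; last exact: sys3_simplification.
split; last exact: sys3_contract.
have [m [w /binary_cocircuit_cocycle binM]] := regular_binary regM.
(* The rank condition gives a triple of [M / e], which is also a triple of [M]. *)
apply: sys3_delete => //; have [C] := set0Pn _ N0.
rewrite inE !cocircuit_contract => /and4P[/andP[h1 _] /andP[h2 _] /andP[h3 _] nC].
by apply/set0Pn; exists C; rewrite inE h1 h2 h3.
Qed.
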